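(* The structure $\mathcal{S} = (\mathbb{A}/_{\simeq_\mathbb{A}^{\text{ae}}},\bullet,[\![-]\!]_{-})$ defined below is a syntactic $\lambda$-model.
   Context: Setting (addressing machines). Fix a countable set $\mathbb{A}$ of addresses and a symbol $\varnothing\notin\mathbb{A}$ (uninitialized register). An addressing machine is a triple $\mathsf{M}=\langle R_0,\dots,R_{r-1},P,T\rangle$ where each register $R_i$ holds $\varnothing$ or an address, $T=[a_1,\dots,a_n]$ is a finite list of addresses (the input tape), and $P$ is a program valid w.r.t. the registers: a list of instructions of shape $\mathsf{Load}\,i$'s, followed by $\mathsf{App}\,i\,j\,k$'s, optionally ending with $\mathsf{Call}\,i$, such that registers are only read (by $\mathsf{App}$ as $i,j$ or by $\mathsf{Call}$) when they exist and are initialized (writing to a non-existing register index, denoted ''$-$'', just discards the value). Let $\mathcal{M}$ be the set of all addressing machines. Fix a bijection $\#:\mathcal{M}\to\mathbb{A}$ with inverse $\#^{-1}$. For a machine $\mathsf{M}$ and tape $T'$, $\mathsf{M}@T'$ is $\mathsf{M}$ with $T'$ appended to its tape; application on addresses is $a\cdot b=\#(\#^{-1}(a)@[b])$. Head reduction $\to_h$ is: $\langle\vec R,\mathsf{Load}\,i;P,a{::}T\rangle\to_h\langle\vec R[R_i:=a],P,T\rangle$; $\langle\vec R,\mathsf{App}\,i\,j\,k;P,T\rangle\to_h\langle\vec R[R_k:=R_i\cdot R_j],P,T\rangle$; $\langle\vec R,\mathsf{Call}\,i,T\rangle\to_h \#^{-1}(R_i)@T$; $\twoheadrightarrow_h$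 is its reflexive-transitive closure. A machine is stuck if its program starts with $\mathsf{Load}$ and its tape is empty; $\mathsf{M}\twoheadrightarrow_h\mathrm{stuck}$ means it reduces to a stuck machine. Applicative equivalence: $\equiv_\mathbb{A}^{\text{ae}}$ is the least equivalence relation on $\mathcal{M}$ closed under: (1) if $\mathsf{M}\twoheadrightarrow_h\mathsf{Z}$ and $\mathsf{Z}=_\mathbb{A}^{\text{ae}}\mathsf{N}$ then $\mathsf{M}\equiv_\mathbb{A}^{\text{ae}}\mathsf{N}$; (2) if $\mathsf{M}\twoheadrightarrow_h\mathrm{stuck}$, $\mathsf{N}\twoheadrightarrow_h\mathrm{stuck}$ and for all $a\in\mathbb{A}$, $\mathsf{M}@[a]\equiv_\mathbb{A}^{\text{ae}}\mathsf{N}@[a]$, then $\mathsf{M}\equiv_\mathbb{A}^{\text{ae}}\mathsf{N}$. Here $a\simeq_\mathbb{A}^{\text{ae}} b$ iff $\#^{-1}(a)\equiv_\mathbb{A}^{\text{ae}}\#^{-1}(b)$, and $\mathsf{Z}=_\mathbb{A}^{\text{ae}}\mathsf{N}$ means they have the same program, the same number of registers with corresponding registers either both $\varnothing$ or holding $\simeq_\mathbb{A}^{\text{ae}}$-related addresses, and tapes of equal length with pointwise $\simeq_\mathbb{A}^{\text{ae}}$-related entries. $\simeq_\mathbb{A}^{\text{ae}}$ is a congruence for $\cdot$. Interpretation. $\Lambda(\mathbb{A})$ is the set of $\lambda$-terms with constants $\underline{a}$ for $a\in\mathbb{A}$. For $M\in\Lambda(\mathbb{A})$ with free variables among $\vec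 x=x_1,\dots,x_n$, define the machine $[M]_{\vec x}$ by: $[x_i]_{\vec x}=\mathsf{Pr}^n_i$, the one-register machine whose program loads its first $n$ tape entries, storing only the $i$-th into $R_0$, then executes $\mathsf{Call}\,0$; $[\underline{a}]_{\vec x}=\mathsf{Cons}^n_a=\langle a,(\mathsf{Load}\,-)^n;\mathsf{Call}\,0,[]\rangle$; $[MN]_{\vec x}=\langle\varnothing^n,\#[M]_{\vec x},\#[N]_{\vec x},\varnothing,\mathsf{Apply}_n,[]\rangle$ where $\mathsf{Apply}_n=\mathsf{Load}(0,\dots,n-1);\mathsf{App}\,n\,0\,n;\cdots;\mathsf{App}\,n\,(n-1)\,n;\mathsf{App}\,(n+1)\,0\,(n+1);\cdots;\mathsf{App}\,(n+1)\,(n-1)\,(n+1);\mathsf{App}\,n\,(n+1)\,(n+2);\mathsf{Call}\,(n+2)$; $[\lambda y.M]_{\vec x}=[M]_{\vec x,y}$ (with $y\notin\vec x$). Then $[a]\bullet[b]=[a\cdot b]$ on $\simeq_\mathbb{A}^{\text{ae}}$-classes, and $[\![M]\!]_\rho$ is the class of $\#([M]_{\vec x}@[\rho(x_1),\dots,\rho(x_n)])$ for a valuation $\rho:\mathrm{Var}\to\mathbb{A}$ (independent of the choice of $\vec x\supseteq FV(M)$). A syntactic $\lambda$-model is $(A,\cdot,[\![-]\!]_-)$ with $(A,\cdot)$ an applicative structure and $[\![-]\!]:\Lambda(A)\times(\mathrm{Var}\to A)\to A$ satisfying: $[\![x]\!]_\rho=\rho(x)$; $[\![\underline a]\!]_\rho=a$;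 $[\![PQ]\!]_\rho=[\![P]\!]_\rho\cdot[\![Q]\!]_\rho$; $[\![\lambda x.P]\!]_\rho\cdot a=[\![P]\!]_{\rho[x:=a]}$ for all $a$; if $\rho,\rho'$ agree on $FV(M)$ then $[\![M]\!]_\rho=[\![M]\!]_{\rho'}$; if $[\![M]\!]_{\rho[x:=a]}=[\![N]\!]_{\rho[x:=a]}$ for all $a\in A$ then $[\![\lambda x.M]\!]_\rho=[\![\lambda x.N]\!]_\rho$. *)

(* Defs.v *)
From mathcomp Require Import all_boot generic_quotient boolp.
From Stdlib Require List Relations.

Set Implicit Arguments.
Unset Strict Implicit.
Unset Printing Implicit Defensive.

Local Open Scope quotient_scope.

(* In [IApp i j k] the result is stored in register [k]. *)
Inductive instr := ILoad (i : nat) | IApp (i j k : nat) | ICall (i : nat).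

Definition program := seq instr.

(* Writing to a non-existing register discards the value. *)
Definition write (T : Type) (s : seq T) (i : nat) (x : T) : seq T :=
  if i < size s then set_nth x s i x else s.

Fixpoint app_shape (P : program) : bool :=
  match P with
  | [::] | [:: ICall _] => true
  | IApp _ _ _ :: P' => app_shape P'
  | _ => false
  end.

Fixpoint prog_shape (P : program) : bool :=
  if P is ILoad _ :: P' then prog_shape P' else app_shape P.

(* [s] has one entry per existing register, telling whether that register is
   initialized when [P] starts. *)
Fixpoint reads_ok (s : seq bool) (P : program) : bool :=
  match P with
  | [::] => true
  | ILoad i :: P' => reads_ok (write s i true) P'
  | IApp i j k :: P' =>
      [&& nth false s i, nth false s j & reads_ok (write s k true) P']
  | ICall i :: P' => nth false s i && reads_ok s P'
  end.

(* The address [None] is the content of an uninitialized register. *)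
Record pre_machine (A : Type) := PreMachine {
  regs : seq (option A);
  prog : program;
  tape : seq A
}.

Definition valid (A : Type) (M : pre_machine A) : bool :=
  prog_shape (prog M) && reads_ok (map isSome (regs M)) (prog M).

Definition machine (A : Type) := {M : pre_machine A | valid M}.

Definition append (A : Type) (M : machine A) (T : seq A) : machine A :=
  exist (fun M => valid M)
    (PreMachine (regs (val M)) (prog (val M)) (tape (val M) ++ T)) (valP M).

Record address_table (A : Type) := AddressTable {
  code : machine A -> A;
  decode : A -> machine A;
  codeK : cancel code decode;
  decodeK : cancel decode code
}.

Section Reduction.
Variables (A : Type) (tbl : address_table A).

Definition app_addr (a b : A) : A := code tbl (append (decode tbl a) [:: b]).

Inductive pre_step : pre_machine A -> pre_machine A -> Prop :=
| step_load R i P a T :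
    pre_step (PreMachine R (ILoad i :: P) (a :: T))
             (PreMachine (write R i (Some a)) P T)
| step_app R i j k P T a b :
    nth None R i = Some a -> nth None R j = Some b ->
    pre_step (PreMachine R (IApp i j k :: P) T)
             (PreMachine (write R k (Some (app_addr a b))) P T)
| step_call R i T a :
    nth None R i = Some a ->
    pre_step (PreMachine R [:: ICall i] T) (val (append (decode tbl a) T)).

Definition step (M N : machine A) : Prop := pre_step (val M) (val N).

Definition hred : machine A -> machine A -> Prop :=
  Relation_Operators.clos_refl_trans (machine A) step.

Definition stuck (M : machine A) : Prop :=
  (exists i P, prog (val M) = ILoad i :: P) /\ tape (val M) = [::].

Definition reduces_to_stuck (M : machine A) : Prop :=
  exists Z, hred M Z /\ stuck Z.

Inductive option_rel (E : A -> A -> Prop) : option A -> option A -> Prop :=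
| option_rel_None : option_rel E None None
| option_rel_Some a b : E a b -> option_rel E (Some a) (Some b).

(* With [E] the applicative equivalence of addresses, this is the relation
   =^ae between machines. *)
Definition machine_rel (E : A -> A -> Prop) (M N : machine A) : Prop :=
  [/\ prog (val M) = prog (val N),
      List.Forall2 (option_rel E) (regs (val M)) (regs (val N))
    & List.Forall2 E (tape (val M)) (tape (val N))].

Inductive ae : machine A -> machine A -> Prop :=
| ae_refl M : ae M M
| ae_sym M N : ae M N -> ae N M
| ae_trans M N P : ae M N -> ae N P -> ae M P
| ae_red M Z N :
    hred M Z -> machine_rel (fun a b => ae (decode tbl a) (decode tbl b)) Z N ->
    ae M N
| ae_stuck M N :
    reduces_to_stuck M -> reduces_to_stuck N ->
    (forall a, ae (append M [:: a]) (append N [:: a])) -> ae M N.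

Definition ae_addr (a b : A) : Prop := ae (decode tbl a) (decode tbl b).

End Reduction.

Section Quotient.
Variables (A : countType) (tbl : address_table A).

Definition ae_addrb (a b : A) : bool := `[< ae_addr tbl a b >].

Lemma ae_addrb_refl : reflexive ae_addrb.
Proof. by move=> a; apply/asboolP/ae_refl. Qed.

Lemma ae_addrb_sym : symmetric ae_addrb.
Proof. by move=> a b; apply/asboolP/asboolP; apply: ae_sym. Qed.

Lemma ae_addrb_trans : transitive ae_addrb.
Proof.
by move=> b a c /asboolP ab /asboolP bc; apply/asboolP; apply: ae_trans ab bc.
Qed.

Canonical ae_addr_equiv := EquivRel ae_addrb
  ae_addrb_refl ae_addrb_sym ae_addrb_trans.

Definition quot : Type := {eq_quot ae_addr_equiv}.

Definition class (a : A) : quot := \pi_({eq_quot ae_addr_equiv}) a.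

Definition rep (x : quot) : A := repr (x : {eq_quot ae_addr_equiv}).

Definition bullet (x y : quot) : quot := class (app_addr tbl (rep x) (rep y)).

End Quotient.

Definition var := nat.

Inductive term (C : Type) :=
| TVar (x : var)
| TCst (c : C)
| TApp (M N : term C)
| TLam (x : var) (M : term C).

Arguments TVar {C} x.

Section Terms.
Variable C : Type.
Implicit Types M N : term C.

Fixpoint fv M : seq var :=
  match M with
  | TVar x => [:: x]
  | TCst _ => [::]
  | TApp M N => fv M ++ fv N
  | TLam x M => [seq y <- fv M | y != x]
  end.

Fixpoint all_vars M : seq var :=
  match M with
  | TVar x => [:: x]
  | TCst _ => [::]
  | TApp M N => all_vars M ++ all_vars N
  | TLam x M => x :: all_vars M
  end.

(* Replaces the free occurrences of [x] by [y]; no capture can occur when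
   [y \notin all_vars M]. *)
Fixpoint rename (x y : var) M : term C :=
  match M with
  | TVar z => TVar (if z == x then y else z)
  | TCst c => TCst c
  | TApp M N => TApp (rename x y M) (rename x y N)
  | TLam z M => TLam z (if z == x then M else rename x y M)
  end.

Inductive alpha : term C -> term C -> Prop :=
| alpha_refl M : alpha M M
| alpha_sym M N : alpha M N -> alpha N M
| alpha_trans M N P : alpha M N -> alpha N P -> alpha M P
| alpha_app M M' N N' :
    alpha M M' -> alpha N N' -> alpha (TApp M N) (TApp M' N')
| alpha_lam x M M' : alpha M M' -> alpha (TLam x M) (TLam x M')
| alpha_rename x y M :
    y \notin all_vars M -> alpha (TLam x M) (TLam y (rename x y M)).

End Terms.

Fixpoint map_term (C D : Type) (f : C -> D) (M : term C) : term D :=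
  match M with
  | TVar x => TVar x
  | TCst c => TCst (f c)
  | TApp M N => TApp (map_term f M) (map_term f N)
  | TLam x M => TLam x (map_term f M)
  end.

Definition upd (X : Type) (rho : var -> X) (x : var) (a : X) : var -> X :=
  fun y => if y == x then a else rho y.

(* Lambda-terms are meant up to alpha-conversion: [sml_alpha] says that [sem]
   is a function on alpha-equivalence classes of raw terms. *)
Record syntactic_lambda_model (X : Type) (app : X -> X -> X)
    (sem : term X -> (var -> X) -> X) : Prop := SyntacticLambdaModel {
  sml_alpha : forall M N rho, alpha M N -> sem M rho = sem N rho;
  sml_var : forall x rho, sem (TVar x) rho = rho x;
  sml_cst : forall a rho, sem (TCst a) rho = a;
  sml_app : forall P Q rho, sem (TApp P Q) rho = app (sem P rho) (sem Q rho);
  sml_lam : forall x P rho a, app (sem (TLam x P) rho) a = sem P (upd rho x a);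
  sml_fv : forall M rho rho',
    {in fv M, rho =1 rho'} -> sem M rho = sem M rho';
  sml_xi : forall x M N rho,
    (forall a, sem M (upd rho x a) = sem N (upd rho x a)) ->
    sem (TLam x M) rho = sem (TLam x N) rho
}.

Lemma prog_shape_loads (s : seq nat) (P : program) :
  prog_shape (map ILoad s ++ P) = prog_shape P.
Proof. by elim: s. Qed.

Lemma reads_ok_loads (s : seq bool) (l : seq nat) (P : program) :
  reads_ok s (map ILoad l ++ P) =
  reads_ok (foldl (fun s i => write s i true) s l) P.
Proof. by elim: l s => //= i l IH s; rewrite IH. Qed.

(* The machines below are indexed from 0, and the non-existing register "-"
   of a one-register machine is the register of index 1. *)
Definition proj_prog (n i : nat) : program :=
  map ILoad [seq if j == i then 0 else 1 | j <- iota 0 n] ++ [:: ICall 0].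

Lemma proj_valid (A : Type) (n : nat) (i : 'I_n) :
  valid (@PreMachine A [:: None] (proj_prog n i) [::]).
Proof.
rewrite /valid /= prog_shape_loads reads_ok_loads /= andbT.
set f := foldl _; set g := fun j => _.
have fT l : f [:: true] (map g l) = [:: true].
  by elim: l => //= j l IH; rewrite /g; case: (j == i).
suff fF l : (i : nat) \in l -> f [:: false] (map g l) = [:: true].
  by rewrite fF // mem_iota /= add0n.
elim: l => //= j l IH; rewrite inE eq_sym /g.
by case: (j =P i) => [_ _|_ /IH]; first exact: fT.
Qed.

Definition proj (A : Type) (n : nat) (i : 'I_n) : machine A :=
  exist (fun M => valid M) _ (proj_valid A i).

Definition cons_prog (n : nat) : program :=
  map ILoad (nseq n 1) ++ [:: ICall 0].

Lemma cons_valid (A : Type) (n : nat) (a : A) :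
  valid (PreMachine [:: Some a] (cons_prog n) [::]).
Proof.
rewrite /valid /= prog_shape_loads reads_ok_loads /= andbT.
by elim: n.
Qed.

Definition cons_machine (A : Type) (n : nat) (a : A) : machine A :=
  exist (fun M => valid M) _ (cons_valid n a).

Definition apply_prog (n : nat) : program :=
  map ILoad (iota 0 n) ++
  [seq IApp n i n | i <- iota 0 n] ++
  [seq IApp n.+1 i n.+1 | i <- iota 0 n] ++
  [:: IApp n n.+1 n.+2; ICall n.+2].

Definition apply_regs (A : Type) (n : nat) (a b : A) : seq (option A) :=
  nseq n None ++ [:: Some a; Some b; None].

Lemma write_true (s : seq bool) (k : nat) :
  nth false s k -> write s k true = s.
Proof.
rewrite /write; case: ltnP => // ks sk.
apply: (@eq_from_nth _ true) => [|i _].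
  by rewrite size_set_nth; apply/maxn_idPr.
rewrite nth_set_nth /=; case: eqP => // ->.
by rewrite (set_nth_default false) // sk.
Qed.

Lemma write_loads (m k : nat) (t : seq bool) :
  foldl (fun s i => write s i true) (nseq m true ++ nseq k false ++ t) (iota m k)
  = nseq (m + k) true ++ t.
Proof.
elim: k m => [|k IH] m /=; first by rewrite addn0.
have -> : write (nseq m true ++ false :: nseq k false ++ t) m true =
          nseq m.+1 true ++ nseq k false ++ t.
  rewrite /write size_cat size_nseq /= -[X in X < _]addn0 ltn_add2l /=.
  by elim: m => //= m ->.
by rewrite IH addSnnS.
Qed.

Lemma reads_ok_apps (s : seq bool) (k : nat) (l : seq nat) (P : program) :
  nth false s k -> all (nth false s) l ->
  reads_ok s ([seq IApp k i k | i <- l] ++ P) = reads_ok s P.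
Proof.
move=> sk; elim: l => //= i l IH /andP[si sl].
by rewrite sk si write_true // IH.
Qed.

Lemma apply_valid (A : Type) (n : nat) (a b : A) :
  valid (PreMachine (apply_regs n a b) (apply_prog n) [::]).
Proof.
rewrite /valid /= prog_shape_loads; apply/andP; split.
  have shape k l P : app_shape ([seq IApp k i k | i <- l] ++ P) = app_shape P.
    by elim: l.
  by case: n => //= n; rewrite !shape /= shape.
rewrite reads_ok_loads /apply_regs map_cat map_nseq /=.
rewrite -[nseq n false ++ _]/(nseq 0 true ++ nseq n false ++ _) write_loads add0n.
set s := nseq n true ++ _.
have sn : nth false s n by rewrite nth_cat size_nseq ltnn subnn.
have sn1 : nth false s n.+1 by rewrite nth_cat size_nseq ltnNge leqnSn subSnn.
have sl : all (nth false s) (iota 0 n).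
  by apply/allP => i; rewrite mem_iota => /= i_n;
     rewrite nth_cat size_nseq i_n nth_nseq i_n.
rewrite !reads_ok_apps //= sn sn1 /= andbT /write size_cat size_nseq /=.
rewrite addn3 ltnSn (set_nth_default true) ?nth_set_nth ?eqxx /= ?eqxx //.
by rewrite size_set_nth leq_maxl.
Qed.

Definition apply_machine (A : Type) (n : nat) (a b : A) : machine A :=
  exist (fun M => valid M) _ (apply_valid n a b).

Lemma idle_valid (A : Type) : valid (@PreMachine A [::] [::] [::]).
Proof. by []. Qed.

Definition idle (A : Type) : machine A :=
  exist (fun M => valid M) _ (idle_valid A).

Section Interpretation.
Variables (A : countType) (tbl : address_table A).

(* If [y] already occurs in [xs], then [TLam y M] has to be alpha-renamed
   before [y] is added to [xs]. Keeping [y] and letting the rightmost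
   occurrence of a variable in the list be the relevant one yields the same
   machine as any such renaming. *)
Definition last_index (x : var) (xs : seq var) : nat :=
  size xs - (index x (rev xs)).+1.

(* Meaningful when [xs] contains the free variables of [M]; variables outside
   [xs] are sent to the dummy machine [idle]. *)
Fixpoint interp (xs : seq var) (M : term A) : machine A :=
  match M with
  | TVar x =>
      if x \in xs then
        if insub (last_index x xs) is Some i then @proj A (size xs) i
        else idle A
      else idle A
  | TCst a => cons_machine (size xs) a
  | TApp M N =>
      apply_machine (size xs) (code tbl (interp xs M)) (code tbl (interp xs N))
  | TLam y M => interp (rcons xs y) M
  end.

Definition interp_addr (xs : seq var) (M : term A) (rho : var -> A) : A :=
  code tbl (append (interp xs M) (map rho xs)).

(* Constants and values of valuations are classes; representatives are chosen
   before the machine is built. *)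
Definition sem (M : term (quot tbl)) (rho : var -> quot tbl) : quot tbl :=
  class tbl (interp_addr (undup (fv M)) (map_term (@rep A tbl) M)
                         (fun x => rep (rho x))).

End Interpretation.

(* Main.v *)
(* A machine [M]_xs fed with values vs for the variables xs reduces to: the
   value of x for a variable x, the machine of address a for a constant a, and
   the application of the two interpretations for a product; fed with fewer
   values it gets stuck, which is the case of an abstraction.  Hence, by
   induction on M, the class of [M]_xs @ vs only depends on the classes of the
   constants and of the values of the free variables, the abstraction case
   being the extensionality rule [ae_stuck].  The same rule gives the
   xi-rule, in a form comparing abstractions over two different variables,
   from which invariance under alpha-conversion follows. *)

Require Import Defs.
From mathcomp Require Import all_boot.
From mathcomp Require Import generic_quotient boolp.
From Stdlib Require List Relations.

Set Implicit Arguments.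
Unset Strict Implicit.
Unset Printing Implicit Defensive.

(** * Writing into registers *)

Section Write.
Variable T : Type.
Implicit Types (s : seq T) (x : T).

Lemma size_write s i x : size (write s i x) = size s.
Proof.
by rewrite /write; case: ltnP => // i_s; rewrite size_set_nth; apply/maxn_idPr.
Qed.

Lemma nth_write x0 s i x j : i < size s ->
  nth x0 (write s i x) j = if j == i then x else nth x0 s j.
Proof.
rewrite /write => i_s; rewrite i_s.
case: (ltnP j (size s)) => j_s.
  rewrite (set_nth_default x) ?size_set_nth ?leq_max ?j_s ?orbT //.
  by rewrite nth_set_nth /=; case: eqP => // _; apply: set_nth_default.
rewrite !nth_default ?size_set_nth //; last by rewrite (maxn_idPr i_s).
by case: eqP => // ji; move: i_s; rewrite -ji ltnNge j_s.
Qed.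

Lemma map_write (U : Type) (f : T -> U) s i x :
  map f (write s i x) = write (map f s) i (f x).
Proof.
rewrite /write size_map; case: ifP => //.
by elim: s i => [|y s IH] [|i] //= i_s; rewrite IH.
Qed.

End Write.

Lemma app_shape_prog_shape P : app_shape P -> prog_shape P.
Proof. by case: P => [|[]]. Qed.

(** * Head reduction and applicative equivalence *)

Section Machines.
Variables (A : Type) (tbl : address_table A).
Local Notation pre_hred :=
  (Relation_Operators.clos_refl_trans _ (pre_step tbl)).
Local Notation app_addr := (app_addr tbl).
Local Notation ae := (ae tbl).
Local Notation ae_addr := (ae_addr tbl).
Local Notation hred := (hred tbl).
Implicit Types (M N Z : machine A) (P : program) (R : seq (option A)).

Lemma append0 M : append M [::] = M.
Proof. by apply: val_inj; case: M => [[R P T] v] /=; rewrite cats0. Qed.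

Lemma append_cat M S T : append (append M S) T = append M (S ++ T).
Proof. by apply: val_inj; rewrite /= catA. Qed.

Lemma decode_app_addr a b :
  decode tbl (app_addr a b) = append (decode tbl a) [:: b].
Proof. exact: codeK. Qed.

Lemma foldl_app_addr a T :
  foldl app_addr a T = code tbl (append (decode tbl a) T).
Proof.
elim: T a => [|b T IH] a /=; first by rewrite append0 decodeK.
by rewrite IH decode_app_addr append_cat.
Qed.

Lemma pre_step_valid (X Y : pre_machine A) :
  pre_step tbl X Y -> valid X -> valid Y.
Proof.
case=> {X Y} [R i P a T|R i j k P T a b _ _|R i T a _].
- by rewrite /valid /= map_write.
- rewrite /valid /= map_write => /andP[/app_shape_prog_shape-> /=].
  by case/and3P.
- by move=> _; exact: valP.
Qed.

(** Validity is an invariant of reduction, so runs can be computed on raw machines without carrying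
    validity proofs along. *)
Lemma hred_pre M (Y : pre_machine A) :
  pre_hred (val M) Y -> exists2 Z, val Z = Y & hred M Z.
Proof.
move E: (val M) => X XY; elim: XY M E => {X Y} [X Y XY|X|X Y Z _ IH1 _ IH2] M E.
- have vY : valid Y by apply: pre_step_valid XY _; rewrite -E; apply: valP.
  exists (exist _ Y vY) => //.
  by apply: Relation_Operators.rt_step; rewrite /step E.
- by exists M => //; apply: Relation_Operators.rt_refl.
- have [M1 /IH2[M2 vM2 M12] M01] := IH1 _ E.
  by exists M2 => //; apply: Relation_Operators.rt_trans M01 M12.
Qed.

Lemma pre_hred_hred M N : pre_hred (val M) (val N) -> hred M N.
Proof. by case/hred_pre => Z /val_inj->. Qed.

(** An instruction inspects at most the head of the tape, and a call hands the whole tape on, so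
    extra input at the end is inert. *)
Lemma hred_append M N T : hred M N -> hred (append M T) (append N T).
Proof.
elim=> {M N} [M N MN|M|M N Z _ IH1 _ IH2].
- apply: Relation_Operators.rt_step; rewrite /step /=.
  case: MN => [R i P a S|R i j k P S a b Ri Rj|R i S a Ri] /=.
  + exact: step_load.
  + exact: step_app.
  + rewrite -catA; exact: (step_call tbl (S ++ T) Ri).
- exact: Relation_Operators.rt_refl.
- exact: Relation_Operators.rt_trans IH1 IH2.
Qed.

Lemma Forall2_refl (B : Type) (E : B -> B -> Prop) (s : seq B) :
  (forall x, E x x) -> List.Forall2 E s s.
Proof. by move=> E_refl; elim: s => [|x s IH]; constructor. Qed.

Lemma machine_rel_refl (E : A -> A -> Prop) M :
  (forall a, E a a) -> machine_rel E M M.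
Proof.
move=> E_refl; split=> //; apply: Forall2_refl => // -[a|].
  exact: option_rel_Some.
exact: option_rel_None.
Qed.

Lemma machine_rel_append (E : A -> A -> Prop) M N S T :
  machine_rel E M N -> List.Forall2 E S T ->
  machine_rel E (append M S) (append N T).
Proof. by case=> pMN rMN tMN ST; split=> //; apply: List.Forall2_app. Qed.

Lemma hred_ae M N : hred M N -> ae M N.
Proof.
by move=> MN; apply: ae_red MN (machine_rel_refl _ _) => a; apply: ae_refl.
Qed.

(** Induction on the derivation: head reduction commutes with appending, and for the extensionality
    rule the conclusion is one of its premises. *)
Lemma ae_append1 M N a : ae M N -> ae (append M [:: a]) (append N [:: a]).
Proof.
elim=> {M N} [M|M N _|M N P _ MN _ NP|M Z N MZ ZN|M N _ _ MN _].
- exact: ae_refl.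
- exact: ae_sym.
- exact: ae_trans MN NP.
- apply: ae_red (hred_append _ MZ) (machine_rel_append ZN _).
  by apply: Forall2_refl => b; apply: ae_refl.
- exact: MN.
Qed.

Lemma ae_app_addr a a' b b' :
  ae_addr a a' -> ae_addr b b' -> ae_addr (app_addr a b) (app_addr a' b').
Proof.
rewrite /Defs.ae_addr !decode_app_addr => aa' bb'.
(* The operator is exchanged first. The arguments then sit on the tapes of one machine and are
   compared by [ae_red] along the empty reduction. *)
apply: ae_trans (ae_append1 b aa') _.
apply: ae_red (Relation_Operators.rt_refl _ _ _) _.
apply: machine_rel_append; first by apply: machine_rel_refl => c; apply: ae_refl.
by constructor; last by constructor.
Qed.

(** * Runs of the projection, constant and application machines *)

Definition load (R : seq (option A)) (l : seq nat) (T : seq A) :=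
  foldl (fun R p => write R p.1 (Some p.2)) R (zip l T).

Lemma pre_hred_loads R l P S T : size l = size S ->
  pre_hred (PreMachine R (map ILoad l ++ P) (S ++ T))
           (PreMachine (load R l S) P T).
Proof.
elim: l S R => [|i l IH] [|a S] R //=.
  by move=> _; apply: Relation_Operators.rt_refl.
move=> [lS]; apply: Relation_Operators.rt_trans (IH S _ lS).
exact/Relation_Operators.rt_step/step_load.
Qed.

(** Register [k] is an accumulator. The operands lie in other registers, so no write disturbs a
    later read. *)
Lemma pre_hred_apps R k l (v : nat -> A) a P T :
  nth None R k = Some a ->
  {in l, forall i, i != k /\ nth None R i = Some (v i)} ->
  exists R', [/\ pre_hred (PreMachine R ([seq IApp k i k | i <- l] ++ P) T)
                          (PreMachine R' P T),
    size R' = size R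
    & forall j, nth None R' j =
        if j == k then Some (foldl app_addr a (map v l)) else nth None R j].
Proof.
elim: l R a => [|i l IH] R a Rk Rl /=.
  exists R; split=> // [|j]; first exact: Relation_Operators.rt_refl.
  by case: eqP => // ->.
have k_R : k < size R.
  by rewrite ltnNge; apply/negP => /(nth_default None); rewrite Rk.
have [_ Ri] := Rl i (mem_head _ _).
have [||R' [RR' sR' R'E]] :=
  IH (write R k (Some (app_addr a (v i)))) (app_addr a (v i)).
- by rewrite nth_write // eqxx.
- move=> j jl; have [jk Rj] : j != k /\ nth None R j = Some (v j).
    by apply: Rl; rewrite inE jl orbT.
  by rewrite nth_write // (negPf jk).
exists R'; split=> [||j].
- apply: Relation_Operators.rt_trans RR'.
  exact/Relation_Operators.rt_step/step_app.
- by rewrite sR' size_write.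
- by rewrite R'E nth_write //; case: eqP.
Qed.

Lemma pre_hred_call R i a :
  nth None R i = Some a ->
  pre_hred (PreMachine R [:: ICall i] [::]) (val (decode tbl a)).
Proof.
move=> Ri; rewrite -[decode tbl a]append0.
exact/Relation_Operators.rt_step/step_call.
Qed.

(** The start [m] and the content [o] vary for the induction: after index [i] has been passed, [o]
    carries the value found. *)
Lemma load_proj d (i m n : nat) o T : size T = n ->
  load [:: o] [seq if j == i then 0 else 1 | j <- iota m n] T =
  [:: if m <= i < m + n then Some (nth d T (i - m)) else o].
Proof.
elim: n m o T => [|n IH] m o [|a T] //=.
  by rewrite addn0 ltnNge; case: leqP.
move=> [Tn]; rewrite /load /= -/(load _ _ _).
case: (eqVneq m i) => [->|mi].
  (* The value is now stored, and the remaining loads go to the missing register 1. *)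
  by rewrite /write /= IH // ltnn leqnn subnn addnS ltnS leq_addr.
rewrite /write /= IH // addSnnS ltn_neqAle mi /=.
case: ifP => // /andP[m_i _].
by rewrite -[i - m]prednK ?subn_gt0 ?ltn_neqAle ?mi // subnS.
Qed.

Lemma hred_proj d n (i : 'I_n) T : size T = n ->
  hred (append (proj A i) T) (decode tbl (nth d T i)).
Proof.
move=> Tn; apply: pre_hred_hred; rewrite /= /proj_prog -[T in PreMachine _ _ T]cats0.
apply: Relation_Operators.rt_trans.
  by apply: pre_hred_loads; rewrite size_map size_iota.
apply: pre_hred_call; rewrite (load_proj d) //=.
by rewrite add0n ltn_ord subn0.
Qed.

Lemma hred_cons n a T : size T = n ->
  hred (append (cons_machine n a) T) (decode tbl a).
Proof.
move=> Tn; apply: pre_hred_hred; rewrite /= /cons_prog -[T in PreMachine _ _ T]cats0.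
apply: Relation_Operators.rt_trans.
  by apply: pre_hred_loads; rewrite size_nseq.
apply: pre_hred_call; rewrite /load.
by elim: n T Tn => [|n IH] [|b T] //= [Tn]; apply: IH.
Qed.

(** For the induction, [S] is the part of the input already loaded. *)
Lemma load_iota S s T : size s = size T ->
  load (map Some S ++ s) (iota (size S) (size T)) T = map Some (S ++ T).
Proof.
elim: T S s => [|b T IH] S [|o s] //=; first by rewrite !cats0.
move=> [sT]; rewrite /load /= -/(load _ _ _).
have -> : write (map Some S ++ o :: s) (size S) (Some b) =
          map Some (rcons S b) ++ s.
  rewrite /write size_cat size_map /= -[X in X < _]addn0 ltn_add2l /=.
  by elim: S {IH} => //= c S ->.
by rewrite -(size_rcons S b) IH // cat_rcons.
Qed.

Lemma load_cat R R' l T : all (gtn (size R)) l ->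
  load (R ++ R') l T = load R l T ++ R'.
Proof.
rewrite /load; elim: l T R => [|i l IH] [|b T] R //= /andP[iR lR].
have -> : write (R ++ R') i (Some b) = write R i (Some b) ++ R'.
  rewrite /write size_cat iR (leq_trans iR (leq_addr _ _)).
  by elim: i R iR {lR} => [|i IHi] [|o R] //= iR; rewrite IHi.
by rewrite IH // size_write.
Qed.

Lemma hred_apply n a b T : size T = n ->
  hred (append (apply_machine n a b) T)
       (decode tbl (app_addr (foldl app_addr a T) (foldl app_addr b T))).
Proof.
move=> Tn; apply: pre_hred_hred; rewrite /= /apply_prog -[T in PreMachine _ _ T]cats0.
apply: Relation_Operators.rt_trans.
  by apply: pre_hred_loads; rewrite size_iota.
have -> : load (apply_regs n a b) (iota 0 n) T =
          map Some T ++ [:: Some a; Some b; None].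
  rewrite /apply_regs load_cat; last first.
    by apply/allP => i; rewrite mem_iota size_nseq.
  by rewrite -[nseq n None]/(map Some [::] ++ _) -Tn (@load_iota [::]) ?size_nseq.
(* Layout: the inputs in registers below [n], then [a] in [n], [b] in [n.+1], and [n.+2] free for
   the result. *)
set R := map Some T ++ _.
have R_T i : i \in iota 0 n -> nth None R i = Some (nth a T i).
  rewrite mem_iota add0n /= => i_n.
  by rewrite nth_cat size_map Tn i_n (nth_map a) ?Tn.
have mapT : map (nth a T) (iota 0 n) = T by rewrite -Tn -/(mkseq _ _) mkseq_nth.
have [||R1 [RR1 sR1 R1E]] := @pre_hred_apps R n (iota 0 n) (nth a T) a
  ([seq IApp n.+1 i n.+1 | i <- iota 0 n] ++ [:: IApp n n.+1 n.+2; ICall n.+2]) [::].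
- by rewrite nth_cat size_map Tn ltnn subnn.
- move=> i i_n; split; last exact: R_T.
  by move: i_n; rewrite mem_iota /=; case: ltngtP.
apply: Relation_Operators.rt_trans RR1 _.
(* The first block changed register [n] only, so the inputs and [b] are still in place. *)
have [||R2 [RR2 sR2 R2E]] := @pre_hred_apps R1 n.+1 (iota 0 n) (nth a T) b
  [:: IApp n n.+1 n.+2; ICall n.+2] [::].
- by rewrite R1E eqn_leq ltnn /= nth_cat size_map Tn ltnNge leqnSn subSnn.
- move=> i i_n; rewrite R1E R_T //; move: i_n; rewrite mem_iota /= add0n => i_n.
  by rewrite !ltn_eqF // (leq_trans i_n).
apply: Relation_Operators.rt_trans RR2 _.
rewrite mapT in R1E R2E.
apply: Relation_Operators.rt_trans.
  apply/Relation_Operators.rt_step/step_app.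
    by rewrite R2E R1E eqn_leq ltnn andbF eqxx.
  by rewrite R2E eqxx.
apply: pre_hred_call; rewrite nth_write ?eqxx //.
(* There are [n + 3] registers, so the write to [n.+2] is not discarded. *)
by rewrite sR2 sR1 size_cat size_map Tn addn3.
Qed.

Lemma reduces_to_stuck_loads M l P T :
  prog (val M) = map ILoad l ++ P -> tape (val M) = [::] -> size T < size l ->
  reduces_to_stuck tbl (append M T).
Proof.
(* The load at position [size T] is the first one to meet an empty tape. *)
move=> pM tM T_l; have [i li] : exists i, drop (size T) l = i :: drop (size T).+1 l.
  by exists (nth 0 l (size T)); rewrite -drop_nth.
have [|Z ZE MZ] := @hred_pre (append M T) (PreMachine
    (load (regs (val M)) (take (size T) l) T) (map ILoad (drop (size T) l) ++ P) [::]).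
  rewrite /= pM tM cat0s -{1}[l](cat_take_drop (size T)) map_cat -catA.
  rewrite -[T in PreMachine _ _ T]cats0; apply: pre_hred_loads.
  by rewrite size_takel // ltnW.
exists Z; split=> //; split; last by rewrite ZE.
by rewrite ZE li /=; exists i; eexists.
Qed.

End Machines.

(** * Environments as a list of variables and a list of values *)

Section Lookup.
Variables (A : Type) (d : A).

Definition lookup (xs : seq var) (vs : seq A) (x : var) : A :=
  nth d vs (last_index x xs).

Lemma last_index_lt x xs : x \in xs -> last_index x xs < size xs.
Proof.
by case: xs => // y xs _; rewrite /last_index ltn_subrL.
Qed.

(** The search runs through the reversed list, so the newest binding shadows older ones. *)
Lemma lookup_rcons xs vs y a x : size vs = size xs -> x \in rcons xs y ->
  lookup (rcons xs y) (rcons vs a) x = if x == y then a else lookup xs vs x.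
Proof.
move=> vxs; rewrite /lookup /last_index rev_rcons size_rcons /= eq_sym.
case: eqVneq => [_ _|yx]; first by rewrite subSS subn0 nth_rcons vxs ltnn eqxx.
rewrite mem_rcons inE (negPf yx) /= subSS => x_xs.
by rewrite nth_rcons vxs last_index_lt.
Qed.

(** Repetitions in [xs] are harmless: every occurrence of [x] carries [rho x]. *)
Lemma lookup_map (rho : var -> A) xs x : x \in xs ->
  lookup xs (map rho xs) x = rho x.
Proof.
move=> x_xs; rewrite /lookup (nth_map 0) ?last_index_lt // /last_index.
have x_rxs : x \in rev xs by rewrite mem_rev.
by rewrite -nth_rev ?nth_index // -size_rev index_mem.
Qed.

End Lookup.

(** * Changing the constants of a term *)

Section MapTerm.
Variables C D : Type.

Lemma fv_map_term (f : C -> D) M : fv (map_term f M) = fv M.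
Proof. by elim: M => //= [M -> N ->|x M ->]. Qed.

Lemma map_term_id (f : C -> C) M : f =1 id -> map_term f M = M.
Proof. by move=> fE; elim: M => //= [c|M -> N ->|x M ->]; rewrite ?fE. Qed.

Lemma map_term_comp (B : Type) (f : C -> D) (g : B -> C) M :
  map_term f (map_term g M) = map_term (f \o g) M.
Proof. by elim: M => //= [M -> N ->|x M ->]. Qed.

End MapTerm.

(** * Behaviour of the interpreting machines *)

Section Interp.
Variables (A : countType) (tbl : address_table A).
Local Notation ae := (ae tbl).
Local Notation ae_addr := (ae_addr tbl).
Local Notation hred := (hred tbl).
Local Notation interp := (interp tbl).
Local Notation value := (lookup (code tbl (idle A))).
Implicit Types (M N : term A) (xs : seq var) (vs : seq A).

Lemma sub_fv_lam (C : Type) (P : term C) x xs :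
  {subset fv (TLam x P) <= xs} -> {subset fv P <= rcons xs x}.
Proof.
move=> sub y yP; rewrite mem_rcons inE; case: eqVneq => //= yx.
by apply: sub; rewrite mem_filter yx.
Qed.

Lemma hred_var xs vs x : x \in xs -> size vs = size xs ->
  hred (append (interp xs (TVar x)) vs) (decode tbl (value xs vs x)).
Proof.
move=> x_xs vxs; rewrite /= x_xs /lookup.
by case: insubP => [i _ <-|/negP[]]; [apply: hred_proj|apply: last_index_lt].
Qed.

Lemma hred_app xs vs M N : size vs = size xs ->
  hred (append (interp xs (TApp M N)) vs)
    (decode tbl (app_addr tbl (code tbl (append (interp xs M) vs))
                              (code tbl (append (interp xs N) vs)))).
Proof.
move/(hred_apply tbl (code tbl (interp xs M)) (code tbl (interp xs N))).
by rewrite !foldl_app_addr !codeK.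
Qed.

(** Only a lower bound on the loads holds, since an abstraction is interpreted over a longer list.
    It makes abstractions stuck on [size xs] inputs. *)
Lemma interp_loads M xs : {subset fv M <= xs} ->
  tape (val (interp xs M)) = [::] /\
  exists l P, prog (val (interp xs M)) = map ILoad l ++ P /\ size xs <= size l.
Proof.
elim: M xs => [x|c|M _ N _|x M IH] xs sub.
- have x_xs : x \in xs by apply: sub; rewrite inE.
  rewrite /= x_xs; case: insubP => [i _ _|/negP[]]; last exact: last_index_lt.
  split=> //; do 2!eexists; split; first by [].
  by rewrite size_map size_iota.
- split=> //; do 2!eexists; split; first by [].
  by rewrite size_nseq.
- split=> //; do 2!eexists; split; first by [].
  by rewrite size_iota.
- have [tM [l [P [pM sl]]]] := IH _ (sub_fv_lam sub).
  split=> //; exists l, P; split=> //.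
  by apply: leq_trans sl; rewrite size_rcons.
Qed.

Lemma reduces_to_stuck_lam x M xs vs :
  {subset fv (TLam x M) <= xs} -> size vs = size xs ->
  reduces_to_stuck tbl (append (interp xs (TLam x M)) vs).
Proof.
move=> /sub_fv_lam sub vxs; have [tM [l [P [pM sl]]]] := interp_loads sub.
by apply: reduces_to_stuck_loads pM tM _; rewrite vxs -(size_rcons xs x).
Qed.

(** An abstraction and its body share one machine, so passing the argument is an equality and not a
    reduction. *)
Lemma interp_lam_append x M xs vs a :
  append (append (interp xs (TLam x M)) vs) [:: a] =
  append (interp (rcons xs x) M) (rcons vs a).
Proof. by rewrite append_cat cats1. Qed.

Lemma ae_lam x y M N xs ys vs ws :
  {subset fv (TLam x M) <= xs} -> {subset fv (TLam y N) <= ys} ->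
  size vs = size xs -> size ws = size ys ->
  (forall a, ae (append (interp (rcons xs x) M) (rcons vs a))
                (append (interp (rcons ys y) N) (rcons ws a))) ->
  ae (append (interp xs (TLam x M)) vs) (append (interp ys (TLam y N)) ws).
Proof.
move=> subx suby vxs wys MN.
by apply: ae_stuck => [||a]; rewrite ?interp_lam_append //;
  apply: reduces_to_stuck_lam.
Qed.

(** Letting lists, values and constants all differ covers at once the independence from [xs] and
    from the chosen representatives. *)
Lemma interp_ae (C : Type) (f g : C -> A) (M : term C) xs ys vs ws :
  (forall c, ae_addr (f c) (g c)) ->
  {subset fv M <= xs} -> {subset fv M <= ys} ->
  size vs = size xs -> size ws = size ys ->
  {in fv M, forall x, ae_addr (value xs vs x) (value ys ws x)} ->
  ae (append (interp xs (map_term f M)) vs) (append (interp ys (map_term g M)) ws).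
Proof.
move=> fg; elim: M xs ys vs ws => [x|c|M IHM N IHN|x M IH] xs ys vs ws
  subx suby vxs wys vw.
- have xM : x \in fv (@TVar C x) by rewrite inE.
  apply: ae_trans (hred_ae (hred_var (subx _ xM) vxs)) _.
  exact: ae_trans (vw x xM) (ae_sym (hred_ae (hred_var (suby _ xM) wys))).
- apply: ae_trans (hred_ae (hred_cons tbl (f c) vxs)) _.
  exact: ae_trans (fg c) (ae_sym (hred_ae (hred_cons tbl (g c) wys))).
- apply: ae_trans (hred_ae (hred_app _ _ vxs)) _.
  apply: ae_trans (ae_sym (hred_ae (hred_app _ _ wys))).
  by apply: ae_app_addr; rewrite /Defs.ae_addr !codeK;
    [apply: IHM|apply: IHN] => // y yM;
    (apply: subx || apply: suby || apply: vw); rewrite mem_cat yM ?orbT.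
(* Both bodies receive the same extra input [a], so the environments stay related at the bound
   variable. *)
- apply: ae_lam; rewrite //= ?fv_map_term // => a.
  apply: IH; rewrite ?size_rcons ?vxs ?wys //; try exact: sub_fv_lam.
  move=> y yM; rewrite !lookup_rcons ?(sub_fv_lam subx) ?(sub_fv_lam suby) //.
  case: (eqVneq y x) => [_|yx]; first exact: ae_refl.
  by apply: vw; rewrite mem_filter yx.
Qed.

End Interp.

(** * The quotient structure and the laws of a model *)

Section Model.
Variables (A : countType) (tbl : address_table A).
Local Notation Q := (quot tbl).
Local Notation class := (class tbl).
Local Notation ae_addr := (ae_addr tbl).
Local Notation bullet := (@bullet A tbl).
Local Notation rep := (@rep A tbl).
Implicit Types (M N : term Q) (rho : var -> Q).

Lemma class_eq a b : class a = class b <-> ae_addr a b.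
Proof.
split=> [/eqmodP/asboolP//|ab]; exact/eqmodP/asboolP.
Qed.

Lemma repK x : class (rep x) = x.
Proof. exact: reprK. Qed.

Lemma rep_class a : ae_addr (rep (class a)) a.
Proof. by apply/class_eq; rewrite repK. Qed.

Lemma bullet_class a b :
  bullet (class a) (class b) = class (app_addr tbl a b).
Proof. by apply/class_eq/ae_app_addr; apply: rep_class. Qed.

Lemma class_interp_eq (C : Type) (f g : C -> A) (M : term C) xs ys
    (rho rho' : var -> A) :
  (forall c, ae_addr (f c) (g c)) ->
  {subset fv M <= xs} -> {subset fv M <= ys} ->
  {in fv M, forall x, ae_addr (rho x) (rho' x)} ->
  class (interp_addr tbl xs (map_term f M) rho) =
  class (interp_addr tbl ys (map_term g M) rho').
Proof.
move=> fg subx suby rr'; apply/class_eq; rewrite /Defs.ae_addr /interp_addr !codeK.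
apply: interp_ae; rewrite ?size_map // => x xM.
by rewrite !lookup_map; [apply: rr'|apply: suby|apply: subx].
Qed.

(** This frees [sem] from its particular list, so that several terms can be interpreted over a
    common one. *)
Lemma sem_interp M rho xs : {subset fv M <= xs} ->
  sem M rho = class (interp_addr tbl xs (map_term rep M) (rep \o rho)).
Proof.
move=> sub; apply: class_interp_eq => //.
- by move=> c; apply: ae_refl.
- by move=> x; rewrite mem_undup.
- by move=> x _; apply: ae_refl.
Qed.

Lemma sem_class (M : term A) (rho : var -> A) xs : {subset fv M <= xs} ->
  sem (map_term class M) (fun x => class (rho x)) = class (interp_addr tbl xs M rho).
Proof.
move=> sub; rewrite (@sem_interp _ _ xs) ?fv_map_term // map_term_comp.
(* Both sides now map constants, by [rep \o class] and by [id], which agree up to equivalence. *)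
rewrite -[in RHS](@map_term_id _ id M) //.
by apply: class_interp_eq => // [c|x _]; apply: rep_class.
Qed.

Lemma sem_var x rho : sem (TVar x) rho = rho x.
Proof.
rewrite -[RHS]repK; apply/class_eq; rewrite /Defs.ae_addr /interp_addr codeK.
have x_xs : x \in undup (fv (@TVar Q x)) by rewrite inE.
apply: ae_trans (hred_ae (hred_var tbl x_xs _)) _; first by rewrite size_map.
by rewrite lookup_map //; apply: ae_refl.
Qed.

Lemma sem_cst a rho : sem (TCst a) rho = a.
Proof.
rewrite -[RHS]repK; apply/class_eq; rewrite /Defs.ae_addr /interp_addr codeK.
exact/hred_ae/hred_cons.
Qed.

Lemma sem_app M N rho : sem (TApp M N) rho = bullet (sem M rho) (sem N rho).
Proof.
(* One list serves all three terms, as the application machine requires; repetitions in it are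
   allowed. *)
set xs := fv (TApp M N).
rewrite (@sem_interp M rho xs) => [|x xM]; last by rewrite mem_cat xM.
rewrite (@sem_interp N rho xs) => [|x xN]; last by rewrite mem_cat xN orbT.
rewrite (@sem_interp _ rho xs) // bullet_class; apply/class_eq.
rewrite /Defs.ae_addr {1}/interp_addr codeK.
by apply/hred_ae/hred_app; rewrite size_map.
Qed.

Lemma class_interp_rcons M x rho a xs : x \notin xs ->
  {subset fv (TLam x M) <= xs} ->
  class (code tbl (append (interp tbl (rcons xs x) (map_term rep M))
                          (rcons (map (rep \o rho) xs) a))) =
  sem M (upd rho x (class a)).
Proof.
move=> x_xs sub; rewrite (sem_interp _ (sub_fv_lam sub)).
apply/class_eq; rewrite /Defs.ae_addr /interp_addr !codeK.
apply: interp_ae; rewrite ?size_rcons ?size_map ?size_rcons //;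
  try exact: sub_fv_lam.
  by move=> c; apply: ae_refl.
move=> y yM; have y_xs := sub_fv_lam sub yM.
rewrite lookup_map // lookup_rcons ?size_map //= /upd.
case: eqVneq => [_|yx]; first by apply: ae_sym; apply: rep_class.
by rewrite lookup_map; [apply: ae_refl|apply: sub; rewrite mem_filter yx].
Qed.

Lemma sem_lam x M rho a : bullet (sem (TLam x M) rho) a = sem M (upd rho x a).
Proof.
rewrite -[a]repK bullet_class /app_addr /interp_addr codeK interp_lam_append.
apply: class_interp_rcons => [|y]; last by rewrite mem_undup.
by rewrite mem_undup mem_filter eqxx.
Qed.

(** Independent binders and valuations make this serve the xi-rule, the dependence on free variables
    and alpha-conversion alike. *)
Lemma sem_xi x y M N rho rho' :
  (forall a, sem M (upd rho x a) = sem N (upd rho' y a)) ->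
  sem (TLam x M) rho = sem (TLam y N) rho'.
Proof.
move=> MN; apply/class_eq; rewrite /Defs.ae_addr /interp_addr !codeK.
have sub z (P : term Q) : {subset fv (TLam z P) <= undup (fv (TLam z P))}.
  by move=> t; rewrite mem_undup.
have notin z (P : term Q) : z \notin undup (fv (TLam z P)).
  by rewrite mem_undup mem_filter eqxx.
apply: ae_lam; rewrite ?size_map //.
- by move: (sub x M); rewrite -(fv_map_term rep (TLam x M)).
- by move: (sub y N); rewrite -(fv_map_term rep (TLam y N)).
- move=> a; have := class_interp_rcons rho a (notin x M) (sub x M).
  rewrite MN -(class_interp_rcons rho' a (notin y N) (sub y N)) => /class_eq.
  by rewrite /Defs.ae_addr !codeK.
Qed.

Lemma sem_fv M rho rho' : {in fv M, rho =1 rho'} -> sem M rho = sem M rho'.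
Proof.
elim: M rho rho' => [x|c|M IHM N IHN|x M IH] rho rho' rr'.
- by rewrite !sem_var rr' // inE.
- by rewrite !sem_cst.
- by rewrite !sem_app (IHM rho rho') 1?(IHN rho rho') // => x xM; apply: rr';
     rewrite mem_cat xM ?orbT.
- apply: sem_xi => a; apply: IH => y yM; rewrite /upd.
  by case: eqVneq => // yx; apply: rr'; rewrite mem_filter yx.
Qed.

(** Two valuations are needed because going under a binder updates both of them. *)
Lemma sem_rename x y M rho rho' : y \notin all_vars M ->
  {in fv M, forall z, rho z = rho' (if z == x then y else z)} ->
  sem M rho = sem (rename x y M) rho'.
Proof.
elim: M rho rho' => [z|c|M IHM N IHN|z M IH] rho rho' /=.
- by move=> _ rr'; rewrite !sem_var rr' // inE.
- by rewrite !sem_cst.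
- rewrite mem_cat negb_or => /andP[yM yN] rr'.
  by rewrite !sem_app (IHM rho rho') 1?(IHN rho rho') // => t tM; apply: rr';
     rewrite mem_cat tM ?orbT.
- rewrite inE negb_or => /andP[yz yM] rr'; apply: sem_xi => a.
  case: (eqVneq z x) => [zx|zx].
    (* The binder shadows [x], so the body is not renamed and the valuations need only agree on its
       free variables. *)
    apply: sem_fv => t tM; rewrite /upd; case: eqVneq => // tz.
    by rewrite rr' ?mem_filter ?tz // -zx (negPf tz).
  apply: IH => // t tM; rewrite /upd; case: (eqVneq t z) => [->|tz].
    by rewrite (negPf zx) eqxx.
  (* Neither [y] nor [t] is the bound variable [z], so the update leaves the renamed [t] alone. *)
  rewrite rr' ?mem_filter ?tz //; case: (eqVneq t x) => _.
    by rewrite (negPf yz).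
  by rewrite (negPf tz).
Qed.

Lemma all_vars_fv (C : Type) (M : term C) : {subset fv M <= all_vars M}.
Proof.
elim: M => [x|c|M IHM N IHN|x M IH] y //=.
  by rewrite !mem_cat => /orP[/IHM->|/IHN->]; rewrite ?orbT.
by rewrite mem_filter inE => /andP[_ /IH->]; rewrite orbT.
Qed.

Lemma sem_alpha M N rho : alpha M N -> sem M rho = sem N rho.
Proof.
move=> MN; elim: MN rho => {M N} [M|M N _ IH|M N P _ MN _ NP|M M' N N' _ IHM _ IHN
                                 |x M M' _ IH|x y M yM] rho //.
- by rewrite MN.
- by rewrite !sem_app IHM IHN.
- by apply: sem_xi => a; apply: IH.
- apply: sem_xi => a; apply: sem_rename => // z zM; rewrite /upd.
  case: eqVneq => _; first by rewrite eqxx.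
  (* A free variable of [M] cannot be the fresh [y], so the update at [y] captures nothing. *)
  by case: eqVneq => // zy; move: yM; rewrite -zy all_vars_fv.
Qed.

End Model.

(* The first two clauses say that the operations of the structure are
   well defined on classes: they satisfy [a] . [b] = [a . b] and
   [[M]]_rho = [ #([M]_xs @ rho(xs)) ] whatever the representatives and
   the list xs of distinct variables containing the free variables of M. *)
Theorem theorem4p10 (A : countType) (tbl : address_table A) :
  [/\ forall a b : A,
        bullet (class tbl a) (class tbl b) = class tbl (app_addr tbl a b),
      forall (M : term A) (rho : var -> A) (xs : seq var),
        uniq xs -> {subset fv M <= xs} ->
        sem (map_term (class tbl) M) (fun x => class tbl (rho x))
          = class tbl (interp_addr tbl xs M rho)
    & syntactic_lambda_model (@bullet A tbl) (@sem A tbl)].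
Proof.
split; first exact: bullet_class.
  by move=> M rho xs _; apply: sem_class.
split=> [M N rho|||||M rho rho'|x M N rho].
- exact: sem_alpha.
- exact: sem_var.
- exact: sem_cst.
- exact: sem_app.
- exact: sem_lam.
- exact: sem_fv.
- exact: sem_xi.
Qed.
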